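(* Let $(P,\cdot_P,\{-,-\}_P)$ be a coherent noncommutative Poisson algebra and let $r\in\wedge^2P$ be a solution of the Poisson Yang-Baxter equation in $P$, i.e. $\mathbf A(r)=\mathbf C(r)=0$. Define $$\delta(x)=(1\otimes\mathrm{ad}_x+\mathrm{ad}_x\otimes1)r,\qquad\Delta(x)=(1\otimes L_x-R_x\otimes1)r,\qquad x\in P.$$ Then the maps $\cdot_{P^*}:=\Delta^*:\otimes^2P^*\to P^*$ and $\{-,-\}_{P^*}:=\delta^*:\wedge^2P^*\to P^*$ induce a coherent noncommutative Poisson algebra structure on $P^*$ such that $(P,P^* )$, i.e. $((P,\cdot_P,\{-,-\}_P),\Delta,\delta)$, is a noncommutative Poisson bialgebra.
   Context: All vector spaces are finite dimensional over an algebraically closed field of characteristic $0$. A noncommutative Poisson algebra $(P,\cdot_P,\{-,-\}_P)$ is a vector space with an associative (not necessarily commutative) product $\cdot_P$ and a Lie bracket $\{-,-\}_P$ such that $\{x,y\cdot_Pz\}_P=\{x,y\}_P\cdot_Pz+y\cdot_P\{x,z\}_P$. It is coherent if $\{x,y\cdot_Pz\}_P+\{y,z\cdot_Px\}_P+\{z,x\cdot_Py\}_P=0$ for all $x,y,z$. Notation: $L_xy=x\cdot_Py$, $R_xy=y\cdot_Px$, $\mathrm{ad}_xy=\{x,y\}_P$, $\tau(x\otimes y)=y\otimes x$; $\wedge^2P\subset P\otimes P$ denotes skew-symmetric tensors. For $r=\sum_ia_i\otimes b_i$, $$\mathbf A(r)=\sum_{i,j}\big(a_i\cdot_Pa_j\otimes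 b_i\otimes b_j+a_i\otimes a_j\otimes b_i\cdot_Pb_j-a_j\otimes a_i\cdot_Pb_j\otimes b_i\big),$$ $$\mathbf C(r)=\sum_{i,j}\big(\{a_i,a_j\}_P\otimes b_i\otimes b_j+a_i\otimes\{b_i,a_j\}_P\otimes b_j+a_i\otimes a_j\otimes\{b_i,b_j\}_P\big).$$ (These are $r_{12}r_{13}+r_{13}r_{23}-r_{23}r_{12}$ and $[r_{12},r_{13}]+[r_{12},r_{23}]+[r_{13},r_{23}]$.) Dual maps: $\langle\Delta^*(\alpha,\beta),x\rangle=\langle\Delta(x),\alpha\otimes\beta\rangle$, $\langle\delta^*(\alpha,\beta),x\rangle=\langle\delta(x),\alpha\otimes\beta\rangle$. A noncommutative Poisson bialgebra is a triple $((P,\cdot_P,\{-,-\}_P),\Delta,\delta)$ with $P$ a coherent noncommutative Poisson algebra and linear maps $\Delta:P\to P\otimes P$, $\delta:P\to\wedge^2P$ such that (a) $(P^*,\Delta^*,\delta^* )$ is a coherent noncommutative Poisson algebra; (b) for all $x,y\in P$: $\Delta(x\cdot_Py)=(1\otimes L_x)\Delta(y)+(R_y\otimes1)\Delta(x)$; $\Delta(\{x,y\}_P)=(\mathrm{ad}_x\otimes1+1\otimes\mathrm{ad}_x)\Delta(y)-(1\otimes L_y)\delta(x)+(R_y\otimes1)\delta(x)$; $\delta(\{x,y\}_P)=(\mathrm{ad}_x\otimes1+1\otimes\mathrm{ad}_x)\delta(y)-(\mathrm{ad}_y\otimes1+1\otimes\mathrm{ad}_y)\delta(x)$; (c) for all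 $x,y\in P$: $(L_y\otimes1-1\otimes R_y)\Delta(x)+\tau\big((L_x\otimes1-1\otimes R_x)\Delta(y)\big)=0$; $(L_x\otimes1)\delta(y)+(R_y\otimes1)\delta(x)+(1\otimes\mathrm{ad}_x)\Delta(y)+(1\otimes\mathrm{ad}_y)\tau(\Delta(x))=\delta(x\cdot_Py)$. *)

(* Defs.v *)
From HB Require Import structures.
From mathcomp Require Import all_boot all_order all_algebra.

Set Implicit Arguments.
Unset Strict Implicit.
Unset Printing Implicit Defensive.

Import GRing.Theory.
Local Open Scope ring_scope.

Reserved Notation "x ⊗ y" (at level 35, right associativity).

Notation bilinear_map f := (bilinear_for *:%R *:%R f).

Section TensorProduct.

(* V ⊗ W is realised by coordinates in the bases vbasis {:V} and vbasis {:W}.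
   The lemmas tensor_bilinear, tliftE and tlift_uniq below are its universal
   property. *)
Definition tens (F : fieldType) (V W : vectType F) : Type :=
  'M[F]_(\dim {:V}, \dim {:W}).

HB.instance Definition _ (F : fieldType) (V W : vectType F) :=
  Vector.on (tens V W).

Variable F : fieldType.

Definition tensor (V W : vectType F) (x : V) (y : W) : tens V W :=
  \matrix_(i, j) (coord (vbasis {:V}) i x * coord (vbasis {:W}) j y).

Local Notation "x ⊗ y" := (tensor x y).

(* For bilinear f, tlift f is the linear map with tlift f (x ⊗ y) = f x y; thus
   tlift (fun a b => f a b) r reads "sum_i f a_i b_i for r = sum_i a_i ⊗ b_i". *)
Definition tlift (V W : vectType F) (U : lmodType F) (f : V -> W -> U)
    (t : tens V W) : U :=
  \sum_i \sum_j t i j *: f (vbasis {:V})`_i (vbasis {:W})`_j.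

Definition tmap (V V' W W' : vectType F) (f : V -> V') (g : W -> W') :
    tens V W -> tens V' W' :=
  tlift (fun x y => f x ⊗ g y).

Definition tflip (V W : vectType F) : tens V W -> tens W V :=
  tlift (fun x y => y ⊗ x).

Definition skew_tensor (V : vectType F) (t : tens V V) : Prop := tflip t = - t.

Lemma tensor_bilinear (V W : vectType F) : bilinear_map (@tensor V W).
Proof.
by split=> [y|x] a u v; apply/matrixP=> i j; rewrite !mxE !linearP /=;
   rewrite ?mulrDl ?mulrDr mulrCA ?mulrA // [a * _]mulrC.
Qed.

Lemma tensorPl (V W : vectType F) a (u v : V) (y : W) :
  (a *: u + v) ⊗ y = a *: (u ⊗ y) + v ⊗ y.
Proof. exact: (tensor_bilinear V W).1. Qed.

Lemma tensorPr (V W : vectType F) a (x : V) (u v : W) :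
  x ⊗ (a *: u + v) = a *: (x ⊗ u) + x ⊗ v.
Proof. exact: (tensor_bilinear V W).2. Qed.

Lemma tlift_linear (V W : vectType F) (U : lmodType F) (f : V -> W -> U) :
  linear (tlift f).
Proof.
move=> a s t; rewrite /tlift scaler_sumr -big_split; apply: eq_bigr => i _.
rewrite scaler_sumr -big_split; apply: eq_bigr => j _ /=.
by rewrite !mxE scalerDl scalerA.
Qed.

HB.instance Definition _ (V W : vectType F) (U : lmodType F) (f : V -> W -> U) :=
  GRing.isLinear.Build F (tens V W) U _ (tlift f) (tlift_linear f).

Lemma tliftE (V W : vectType F) (U : lmodType F) (f : V -> W -> U) :
  bilinear_map f -> forall x y, tlift f (x ⊗ y) = f x y.
Proof.
move=> fB x y.
pose fl v : {linear V -> U} :=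
  HB.pack (f^~ v) (GRing.isLinear.Build _ _ _ _ (f^~ v) (fB.1 v)).
pose fr u : {linear W -> U} :=
  HB.pack (f u) (GRing.isLinear.Build _ _ _ _ (f u) (fB.2 u)).
rewrite [in RHS](coord_vbasis (memvf x)) -[RHS]/(fl y _) linear_sum /tlift.
apply: eq_bigr => i _; rewrite linearZ /=.
rewrite [in RHS](coord_vbasis (memvf y)) -[f _ _]/(fr _ _) linear_sum.
rewrite scaler_sumr; apply: eq_bigr => j _.
by rewrite linearZ /= scalerA mxE.
Qed.

Lemma tensor_sum (V W : vectType F) (t : tens V W) :
  t = \sum_i \sum_j t i j *: ((vbasis {:V})`_i ⊗ (vbasis {:W})`_j).
Proof.
apply/matrixP=> k l; rewrite summxE (bigD1 k) //= [X in _ + X]big1 => [|i ik].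
  rewrite addr0 summxE (bigD1 l) //= [X in _ + X]big1 => [|j jl].
    by rewrite !mxE !coord_free ?(basis_free (vbasisP _)) // !eqxx !mulr1 addr0.
  rewrite !mxE !coord_free ?(basis_free (vbasisP _)) //.
  by rewrite (negPf jl) !mulr0.
rewrite summxE big1 // => j _; rewrite !mxE !coord_free ?(basis_free (vbasisP _)) //.
by rewrite (negPf ik) mul0r mulr0.
Qed.

Lemma tlift_uniq (V W : vectType F) (U : lmodType F) (f : V -> W -> U)
    (g : {linear tens V W -> U}) :
  (forall x y, g (x ⊗ y) = f x y) -> g =1 tlift f.
Proof.
move=> gf t; rewrite {1}(tensor_sum t) linear_sum; apply: eq_bigr => i _.
by rewrite linear_sum; apply: eq_bigr => j _; rewrite linearZ /= gf.
Qed.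

End TensorProduct.

Notation "x ⊗ y" := (tensor x y) : ring_scope.

Section Algebra.

Variables (F : fieldType) (P : vectType F).
Implicit Types mul br : P -> P -> P.

Record nc_poisson mul br : Prop := NcPoisson {
  nc_mul_bilinear : bilinear_map mul;
  nc_mulA : associative mul;
  nc_br_bilinear : bilinear_map br;
  nc_br_alt : forall x, br x x = 0;
  nc_br_jacobi : forall x y z, br x (br y z) + br y (br z x) + br z (br x y) = 0;
  nc_leibniz : forall x y z, br x (mul y z) = mul (br x y) z + mul y (br x z)
}.

Record coherent_nc_poisson mul br : Prop := CoherentNcPoisson {
  coherent_poisson : nc_poisson mul br;
  coherent_cycle : forall x y z,
    br x (mul y z) + br y (mul z x) + br z (mul x y) = 0
}.

End Algebra.

Section Bialgebra.

Variables (F : fieldType) (P : vectType F).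
Implicit Types mul br : P -> P -> P.

(* Triple tensors are nested to the right: P ⊗ (P ⊗ P). With (a, b) standing for
   (a_i, b_i) and (a', b') for (a_j, b_j), these are
   A(r) = r12 r13 + r13 r23 - r23 r12 and C(r) = [r12,r13] + [r12,r23] + [r13,r23];
   see assoc_ybE and classical_ybE. *)
Definition assoc_yb mul (r : tens P P) : tens P (tens P P) :=
  tlift (fun a b => tlift (fun a' b' =>
    mul a a' ⊗ b ⊗ b' + a ⊗ a' ⊗ mul b b' - a' ⊗ mul a b' ⊗ b) r) r.

Definition classical_yb br (r : tens P P) : tens P (tens P P) :=
  tlift (fun a b => tlift (fun a' b' =>
    br a a' ⊗ b ⊗ b' + a ⊗ br b a' ⊗ b' + a ⊗ a' ⊗ br b b') r) r.

Record poisson_yb mul br (r : tens P P) : Prop := PoissonYB {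
  poisson_yb_assoc : assoc_yb mul r = 0;
  poisson_yb_classical : classical_yb br r = 0
}.

Definition dual : vectType F := 'Hom(P, F^o).

Definition tpair (t : tens P P) (u v : dual) : F^o :=
  tlift (fun x y => u x * v y : F^o) t.

(* The dual product of a linear map D : P -> P ⊗ P; the functional
   x |-> <D x, u ⊗ v> is linear when D is, so linfun represents it (dual_mulE). *)
Definition dual_mul (D : P -> tens P P) (u v : dual) : dual :=
  linfun (fun x => tpair (D x) u v).

Record nc_poisson_bialgebra mul br (D d : P -> tens P P) : Prop :=
    NcPoissonBialgebra {
  bialg_coherent : coherent_nc_poisson mul br;
  bialg_D_linear : linear D;
  bialg_d_linear : linear d;
  bialg_d_skew : forall x, skew_tensor (d x);
  bialg_dual_coherent : coherent_nc_poisson (dual_mul D) (dual_mul d);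
  bialg_D_mul : forall x y,
    D (mul x y) = tmap id (mul x) (D y) + tmap (mul^~ y) id (D x);
  bialg_D_br : forall x y,
    D (br x y) = (tmap (br x) id (D y) + tmap id (br x) (D y))
                 - tmap id (mul y) (d x) + tmap (mul^~ y) id (d x);
  bialg_d_br : forall x y,
    d (br x y) = (tmap (br x) id (d y) + tmap id (br x) (d y))
                 - (tmap (br y) id (d x) + tmap id (br y) (d x));
  bialg_D_sym : forall x y,
    (tmap (mul y) id (D x) - tmap id (mul^~ y) (D x))
    + tflip (tmap (mul x) id (D y) - tmap id (mul^~ x) (D y)) = 0;
  bialg_d_mul : forall x y,
    tmap (mul x) id (d y) + tmap (mul^~ y) id (d x)
    + tmap id (br x) (D y) + tmap id (br y) (tflip (D x)) = d (mul x y)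
}.

Definition cobracket_of br (r : tens P P) (x : P) : tens P P :=
  tmap id (br x) r + tmap (br x) id r.

Definition coproduct_of mul (r : tens P P) (x : P) : tens P P :=
  tmap id (mul x) r - tmap (mul^~ x) id r.

Lemma tpairE x y (u v : dual) : tpair (x ⊗ y) u v = u x * v y.
Proof.
rewrite /tpair tliftE //; split=> [b|a] k s t /=; rewrite linearP /=.
  by rewrite mulrDl /GRing.scale /= mulrA.
by rewrite mulrDr /GRing.scale /= mulrCA.
Qed.

Lemma dual_mulE (D : P -> tens P P) (u v : dual) x :
  linear D -> dual_mul D u v x = tpair (D x) u v.
Proof.
move=> D_lin.
pose g : {linear P -> F^o} := HB.pack (fun x => tpair (D x) u v)
  (GRing.isLinear.Build F P F^o *:%R (fun x => tpair (D x) u v)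
    (fun a s t => etrans (congr1 (fun w => tpair w u v) (D_lin a s t))
                         (tlift_linear _ a (D s) (D t)))).
by rewrite /dual_mul -[RHS]/(g x) -(lfunE g x).
Qed.

Lemma tlift2_sum (U : vectType F) (h : P -> P -> P -> P -> U) (I : finType)
    (a b : I -> P) :
  (forall x y, bilinear_map (h x y)) ->
  (forall x' y', bilinear_map (fun x y => h x y x' y')) ->
  let r := \sum_i a i ⊗ b i in
  tlift (fun x y => tlift (h x y) r) r
  = \sum_i \sum_j h (a i) (b i) (a j) (b j).
Proof.
move=> hB hB' r; have rE x y : tlift (h x y) r = \sum_j h x y (a j) (b j).
  by rewrite linear_sum; apply: eq_bigr => j _; apply: tliftE.
rewrite {2}/r linear_sum; apply: eq_bigr => i _.
rewrite /= tliftE ?rE //; split=> [y|x] k s t; rewrite /= !rE scaler_sumr -big_split;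
  apply: eq_bigr => j _; first exact: (hB' _ _).1.
exact: (hB' _ _).2.
Qed.

Lemma assoc_ybE mul (I : finType) (a b : I -> P) : bilinear_map mul ->
  assoc_yb mul (\sum_i a i ⊗ b i) = \sum_i \sum_j
    (mul (a i) (a j) ⊗ b i ⊗ b j + a i ⊗ a j ⊗ mul (b i) (b j)
     - a j ⊗ mul (a i) (b j) ⊗ b i).
Proof.
move=> mulB.
have mulL k s t y : mul (k *: s + t) y = k *: mul s y + mul t y := mulB.1 y k s t.
have mulR k s t x : mul x (k *: s + t) = k *: mul x s + mul x t := mulB.2 x k s t.
apply: (@tlift2_sum _ (fun a b a' b' =>
    mul a a' ⊗ b ⊗ b' + a ⊗ a' ⊗ mul b b' - a' ⊗ mul a b' ⊗ b));
  by move=> x y; split=> z k s t /=;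
     rewrite !(mulL, mulR, tensorPl, tensorPr) !(scalerDr, scalerN, opprD);
     rewrite [RHS]addrACA; congr (_ + _); exact: addrACA.
Qed.

Lemma classical_ybE br (I : finType) (a b : I -> P) : bilinear_map br ->
  classical_yb br (\sum_i a i ⊗ b i) = \sum_i \sum_j
    (br (a i) (a j) ⊗ b i ⊗ b j + a i ⊗ br (b i) (a j) ⊗ b j
     + a i ⊗ a j ⊗ br (b i) (b j)).
Proof.
move=> brB.
have brL k s t y : br (k *: s + t) y = k *: br s y + br t y := brB.1 y k s t.
have brR k s t x : br x (k *: s + t) = k *: br x s + br x t := brB.2 x k s t.
apply: (@tlift2_sum _ (fun a b a' b' =>
    br a a' ⊗ b ⊗ b' + a ⊗ br b a' ⊗ b' + a ⊗ a' ⊗ br b b'));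
  by move=> x y; split=> z k s t /=;
     rewrite !(brL, brR, tensorPl, tensorPr) !scalerDr;
     rewrite [RHS]addrACA; congr (_ + _); exact: addrACA.
Qed.

End Bialgebra.

(* Main.v *)
(* Let T : P^* -> P be contraction with r, so that v (T u) = - u (T v). On P^* the
   product and bracket read (u v)(x) = v (x T(u)) + u (T(v) x) and
   {u, v}(x) = v {x, T u} - u {x, T v}, and the Yang-Baxter equation says exactly
   that T is multiplicative and preserves brackets. Each axiom on P^*, evaluated
   at x, then splits into identities of P in x and the images under T; coherence
   of P is what the Leibniz rule on P^* needs. The compatibility conditions hold
   termwise for r = sum_i a_i ⊗ b_i, up to swapping tensor factors by skewness. *)

Require Import Defs.
From mathcomp Require Import all_boot all_order all_algebra.
From mathcomp Require Import ring.
Local Open Scope ring_scope.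

Import GRing.Theory.

Set Implicit Arguments.
Unset Strict Implicit.
Unset Printing Implicit Defensive.

(** * Elementary consequences of bilinearity *)

Section Bilinear.

Variables (F : fieldType) (U V W : lmodType F) (f : U -> V -> W).
Hypothesis fB : bilinear_map f.

Lemma bilinearDl y : {morph f^~ y : u v / u + v}.
Proof. by move=> u v /=; have := fB.1 y 1 u v; rewrite /= !scale1r. Qed.

Lemma bilinearDr x : {morph f x : u v / u + v}.
Proof. by move=> u v /=; have := fB.2 x 1 u v; rewrite /= !scale1r. Qed.

Lemma bilinear0l y : f 0 y = 0.
Proof. by apply: (addrI (f 0 y)); rewrite -bilinearDl !addr0. Qed.

Lemma bilinear0r x : f x 0 = 0.
Proof. by apply: (addrI (f x 0)); rewrite -bilinearDr !addr0. Qed.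

Lemma bilinearZl y k u : f (k *: u) y = k *: f u y.
Proof. by have := fB.1 y k u 0; rewrite /= bilinear0l !addr0. Qed.

Lemma bilinearZr x k u : f x (k *: u) = k *: f x u.
Proof. by have := fB.2 x k u 0; rewrite /= bilinear0r !addr0. Qed.

Lemma bilinearNl y u : f (- u) y = - f u y.
Proof. by rewrite -scaleN1r bilinearZl scaleN1r. Qed.

Lemma bilinearNr x u : f x (- u) = - f x u.
Proof. by rewrite -scaleN1r bilinearZr scaleN1r. Qed.

Lemma bilinear_sumr (I : finType) x (k : I -> F) (b : I -> V) :
  f x (\sum_i k i *: b i) = \sum_i k i *: f x (b i).
Proof.
rewrite (big_morph (f x) (bilinearDr x) (bilinear0r x)).
by apply: eq_bigr => i _; rewrite bilinearZr.
Qed.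

Lemma bilinear_suml (I : finType) y (k : I -> F) (a : I -> U) :
  f (\sum_i k i *: a i) y = \sum_i k i *: f (a i) y.
Proof.
rewrite (big_morph (f^~ y) (bilinearDl y) (bilinear0l y)).
by apply: eq_bigr => i _; rewrite bilinearZl.
Qed.

End Bilinear.

(** * Computing with sums of pure tensors *)

Section TensorCalculus.

Variable F : fieldType.

(** Absorbing each coordinate into the left factor leaves a sum without scalars. Later identities
    can then be checked on the summands [a i ⊗ b i]. *)
Lemma tens_finite_sum (V W : vectType F) (t : tens V W) :
  exists (I : finType) (a : I -> V) (b : I -> W), t = \sum_i a i ⊗ b i.
Proof.
exists ('I_(\dim {:V}) * 'I_(\dim {:W}))%type.
exists (fun p => t p.1 p.2 *: (vbasis {:V})`_(p.1 : 'I_(\dim {:V}))),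
       (fun p => (vbasis {:W})`_(p.2 : 'I_(\dim {:W}))).
rewrite {1}(tensor_sum t) pair_bigA; apply: eq_bigr => p _ /=.
by rewrite (bilinearZl (tensor_bilinear V W)).
Qed.

Lemma tmap_bilinear (V V' W W' : vectType F) (f : V -> V') (g : W -> W') :
  linear f -> linear g -> bilinear_map (fun x y => f x ⊗ g y).
Proof.
by move=> fL gL; split=> [y|x] k s t /=; rewrite ?fL ?gL ?tensorPl ?tensorPr.
Qed.

Lemma tmapE (V V' W W' : vectType F) (f : V -> V') (g : W -> W') x y :
  linear f -> linear g -> tmap f g (x ⊗ y) = f x ⊗ g y.
Proof. by move=> fL gL; rewrite /tmap tliftE //; apply: tmap_bilinear. Qed.

Lemma tflipE (V W : vectType F) (x : V) (y : W) : tflip (x ⊗ y) = y ⊗ x.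
Proof.
by rewrite /tflip tliftE //; split=> [v|u] k s t /=; rewrite ?tensorPl ?tensorPr.
Qed.

Lemma tflip_sum (V W : vectType F) (I : finType) (t : I -> tens V W) :
  tflip (\sum_i t i) = \sum_i tflip (t i).
Proof. exact: linear_sum. Qed.

Lemma tmap_sum (V V' W W' : vectType F) (f : V -> V') (g : W -> W')
    (I : finType) (t : I -> tens V W) :
  tmap f g (\sum_i t i) = \sum_i tmap f g (t i).
Proof. exact: linear_sum. Qed.

Lemma tflipB (V W : vectType F) : {morph @tflip F V W : s t / s - t}.
Proof. exact: linearB. Qed.

Lemma tflipD (V W : vectType F) : {morph @tflip F V W : s t / s + t}.
Proof. exact: linearD. Qed.

Lemma tmapB (V V' W W' : vectType F) (f : V -> V') (g : W -> W') :
  {morph tmap f g : s t / s - t}.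
Proof. exact: linearB. Qed.

Lemma tmapD (V V' W W' : vectType F) (f : V -> V') (g : W -> W') :
  {morph tmap f g : s t / s + t}.
Proof. exact: linearD. Qed.

(** Apply [tlift h] to both sides of the skewness equation. Every later exchange of [a i] and [b i]
    goes through this lemma. *)
Lemma skew_sum (V : vectType F) (U : lmodType F) (I : finType) (a b : I -> V)
    (h : V -> V -> U) :
  bilinear_map h -> skew_tensor (\sum_i a i ⊗ b i) ->
  \sum_i h (b i) (a i) = - \sum_i h (a i) (b i).
Proof.
move=> hB; rewrite /skew_tensor tflip_sum => /(congr1 (tlift h)).
rewrite linearN !(linear_sum (tlift h)) /=.
under eq_bigr do rewrite tflipE tliftE //.
by under [X in - X]eq_bigr do rewrite tliftE //.
Qed.

End TensorCalculus.

(** * Functionals separate points *)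

Section Dual.

Variables (F : fieldType) (P : vectType F).

Lemma dual_separates (x y : P) : (forall w : dual P, w x = w y) -> x = y.
Proof.
move=> E; rewrite (coord_vbasis (memvf x)) (coord_vbasis (memvf y)).
apply: eq_bigr => i _; congr (_ *: _).
have := E (linfun (coord (vbasis {:P}) i : P -> F^o)).
by rewrite !lfunE.
Qed.

End Dual.

(** * Coboundary maps: identities that hold summand by summand *)

Section Coboundary.

Variables (F : fieldType) (P : vectType F) (mul br : P -> P -> P).
Hypothesis hP : coherent_nc_poisson mul br.

Let nP := coherent_poisson hP.
Let mulB := nc_mul_bilinear nP.
Let brB := nc_br_bilinear nP.
Let mulLl x : linear (mul x) := mulB.2 x.
Let mulRl x : linear (mul^~ x) := mulB.1 x.
Let brLl x : linear (br x) := brB.2 x.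
Let mulA := nc_mulA nP.

Lemma nc_brC x y : br x y = - br y x.
Proof.
apply/eqP; rewrite -addr_eq0; apply/eqP.
have := nc_br_alt nP (x + y).
rewrite (bilinearDl brB) !(bilinearDr brB) !(nc_br_alt nP).
by rewrite add0r addr0.
Qed.

Let idl : linear (@idfun P). Proof. by []. Qed.

Variables (I : finType) (a b : I -> P).
Let r : tens P P := \sum_i a i ⊗ b i.

(** Leaving [f] and [g] general covers every operator occurring in the compatibility conditions, and
    the identity as well. Each condition becomes a comparison of two sums over the same index. *)
Lemma tmap_coproduct x (f g : P -> P) : linear f -> linear g ->
  tmap f g (coproduct_of mul r x)
  = \sum_i (f (a i) ⊗ g (mul x (b i)) - f (mul (a i) x) ⊗ g (b i)).
Proof.
move=> fL gL; rewrite /coproduct_of /r tmapB !tmap_sum sumrB.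
congr (_ - _); apply: eq_bigr => i _.
  by rewrite (tmapE _ _ idl (mulLl x)) tmapE.
by rewrite (tmapE _ _ (mulRl x) idl) tmapE.
Qed.

Lemma tmap_cobracket x (f g : P -> P) : linear f -> linear g ->
  tmap f g (cobracket_of br r x)
  = \sum_i (f (a i) ⊗ g (br x (b i)) + f (br x (a i)) ⊗ g (b i)).
Proof.
move=> fL gL; rewrite /cobracket_of /r tmapD !tmap_sum big_split.
congr (_ + _); apply: eq_bigr => i _.
  by rewrite (tmapE _ _ idl (brLl x)) tmapE.
by rewrite (tmapE _ _ (brLl x) idl) tmapE.
Qed.

Lemma tmap_id (t : tens P P) : tmap idfun idfun t = t.
Proof. by symmetry; rewrite [in LHS](tensor_sum t). Qed.

Lemma coproductE x : coproduct_of mul r x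
  = \sum_i (a i ⊗ mul x (b i) - mul (a i) x ⊗ b i).
Proof. by rewrite -[LHS]tmap_id tmap_coproduct. Qed.

Lemma cobracketE x : cobracket_of br r x
  = \sum_i (a i ⊗ br x (b i) + br x (a i) ⊗ b i).
Proof. by rewrite -[LHS]tmap_id tmap_cobracket. Qed.

Lemma coproduct_linear : linear (coproduct_of mul r).
Proof.
move=> k x y; rewrite !coproductE scaler_sumr -big_split; apply: eq_bigr => i _.
(* Tensors are coordinate matrices, so comparing entries leaves an identity of scalars within reach
   of [ring]. *)
apply/matrixP=> p q; rewrite /= (mulB.1 (b i)) (mulB.2 (a i)) !mxE !linearP /=.
by ring.
Qed.

Lemma cobracket_linear : linear (cobracket_of br r).
Proof.
move=> k x y; rewrite !cobracketE scaler_sumr -big_split; apply: eq_bigr => i _.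
apply/matrixP=> p q; rewrite /= (brB.1 (b i)) (brB.1 (a i)) !mxE !linearP /=.
by ring.
Qed.

(** The mixed terms [mul (a i) y ⊗ mul x (b i)] cancel, and the others agree by associativity. *)
Lemma coproduct_mul x y : coproduct_of mul r (mul x y) =
  tmap id (mul x) (coproduct_of mul r y)
  + tmap (mul^~ y) id (coproduct_of mul r x).
Proof.
rewrite !tmap_coproduct // coproductE -big_split; apply: eq_bigr => i _.
by apply/matrixP=> p q; rewrite /= !mulA !mxE; ring.
Qed.

Let brJ x y z : br (br x y) z = br x (br y z) - br y (br x z).
Proof.
have := nc_br_jacobi nP x y z; rewrite (nc_brC z x) (bilinearNr brB).
rewrite (nc_brC z (br x y)) => E.
by apply/eqP; rewrite -subr_eq0 -oppr_eq0 opprB E.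
Qed.

Let brM := nc_leibniz nP.

(** Since [br x] is a derivation of [mul], expanding by Leibniz makes the terms in which both
    factors are modified cancel. *)
Lemma coproduct_br x y : coproduct_of mul r (br x y) =
  (tmap (br x) id (coproduct_of mul r y) + tmap id (br x) (coproduct_of mul r y))
  - tmap id (mul y) (cobracket_of br r x) + tmap (mul^~ y) id (cobracket_of br r x).
Proof.
rewrite !tmap_coproduct // !tmap_cobracket // coproductE.
rewrite -sumrN -!big_split; apply: eq_bigr => i _.
by apply/matrixP=> p q; rewrite /= !brM !mxE !linearD /=; ring.
Qed.

Lemma cobracket_br x y : cobracket_of br r (br x y) =
  (tmap (br x) id (cobracket_of br r y) + tmap id (br x) (cobracket_of br r y))
  - (tmap (br y) id (cobracket_of br r x) + tmap id (br y) (cobracket_of br r x)).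
Proof.
rewrite !tmap_cobracket // cobracketE.
rewrite -!big_split -sumrN -big_split; apply: eq_bigr => i _.
by apply/matrixP=> p q; rewrite /= !brJ !mxE !linearB /=; ring.
Qed.

(** * Compatibility conditions involving the flip *)

Hypothesis r_skew : skew_tensor r.

Lemma tflip_tmap_coproduct x (f g : P -> P) : linear f -> linear g ->
  tflip (tmap f g (coproduct_of mul r x))
  = \sum_i (g (a i) ⊗ f (mul (b i) x) - g (mul x (a i)) ⊗ f (b i)).
Proof.
move=> fL gL; rewrite tmap_coproduct // tflip_sum.
transitivity (\sum_i (g (mul x (b i)) ⊗ f (a i) - g (b i) ⊗ f (mul (a i) x))).
  by apply: eq_bigr => i _; rewrite tflipB !tflipE.
(* The flip has put [b i] on the left. Skewness restores [a i] there at the cost of a sign, so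
   flipped and unflipped sums can be matched termwise. *)
rewrite (skew_sum (h := fun u v => g (mul x u) ⊗ f v - g u ⊗ f (mul v x))) //.
  by rewrite -sumrN; apply: eq_bigr => i _; rewrite opprB.
split=> [v|u] k s t; apply/matrixP=> p q; rewrite /= !(mulLl, mulRl);
by rewrite ?(fL, gL) ?(mulLl, mulRl) !mxE !linearP /=; ring.
Qed.

Lemma cobracket_skew x : skew_tensor (cobracket_of br r x).
Proof.
rewrite /skew_tensor cobracketE tflip_sum.
transitivity (\sum_i (b i ⊗ br x (a i) + br x (b i) ⊗ a i)).
  by apply: eq_bigr => i _; rewrite tflipD !tflipE addrC.
rewrite (skew_sum (h := fun u v => u ⊗ br x v + br x u ⊗ v)) //.
by split=> [v|u] k s t; apply/matrixP=> p q;
   rewrite /= !brLl !mxE !linearP /=; ring.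
Qed.

Lemma coproduct_sym x y :
  (tmap (mul y) id (coproduct_of mul r x)
   - tmap id (mul^~ y) (coproduct_of mul r x))
  + tflip (tmap (mul x) id (coproduct_of mul r y)
           - tmap id (mul^~ x) (coproduct_of mul r y)) = 0.
Proof.
rewrite tflipB !tflip_tmap_coproduct // !tmap_coproduct //.
rewrite -!sumrB -big_split big1 //= => i _.
by apply/matrixP=> p q; rewrite !mulA !mxE; ring.
Qed.

Let brMr x y z : br (mul x y) z = mul x (br y z) + mul (br x z) y.
Proof.
by rewrite nc_brC brM (nc_brC z x) (nc_brC z y) (bilinearNl mulB)
  (bilinearNr mulB) opprD !opprK addrC.
Qed.

(** Coherence combined with antisymmetry: a product in the second slot of a bracket moves to the
    first slot, where [brMr] applies. *)
Lemma coherentE x y z : br x (mul y z) = br (mul z x) y + br (mul x y) z.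
Proof.
apply/eqP; rewrite -subr_eq0 opprD addrA -!(nc_brC y) -(nc_brC z).
by rewrite (coherent_cycle hP).
Qed.

Lemma cobracket_mul x y :
  tmap (mul x) id (cobracket_of br r y) + tmap (mul^~ y) id (cobracket_of br r x)
  + tmap id (br x) (coproduct_of mul r y)
  + tmap id (br y) (tflip (coproduct_of mul r x)) = cobracket_of br r (mul x y).
Proof.
(* Bringing the flip outermost gives the form handled by [tflip_tmap_coproduct]. *)
have -> : tmap id (br y) (tflip (coproduct_of mul r x))
        = tflip (tmap (br y) id (coproduct_of mul r x)).
  rewrite coproductE tflip_sum !tmap_sum tflip_sum; apply: eq_bigr => i _.
  by rewrite tflipB !tmapB !tmapE // tflipB !tflipE !tmapE.
rewrite tflip_tmap_coproduct // !tmap_coproduct // !tmap_cobracket // cobracketE.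
rewrite -!big_split; apply: eq_bigr => i _ /=.
(* The same bracket with [mul x y] is expanded in two ways: by coherence on the right factor [b i],
   by Leibniz on the left factor [a i]. *)
have -> : br (mul x y) (b i) = br x (mul y (b i)) + br y (mul (b i) x).
  by rewrite coherentE (nc_brC y) addrAC subrr add0r.
by rewrite brMr; apply/matrixP=> p q; rewrite !mxE !linearD /=; ring.
Qed.

(** * Contraction with [r] and the dual operations *)

Definition contract (u : dual P) : P := \sum_i (u (a i) : F) *: b i.

Lemma contract_skew (u : dual P) : \sum_i (u (b i) : F) *: a i = - contract u.
Proof.
rewrite (skew_sum (h := fun x y => (u x : F) *: y)) //.
split=> [y|x] k s t /=; first by rewrite linearP scalerDl -scalerA.
by rewrite scalerDr !scalerA mulrC.
Qed.

Lemma dual_sum (u : dual P) (k : I -> F) (x : I -> P) :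
  u (\sum_i k i *: x i) = \sum_i k i * (u (x i) : F) :> F.
Proof. by rewrite linear_sum; apply: eq_bigr => i _; rewrite linearZ. Qed.

Lemma contract_adj (u v : dual P) : v (contract u) = - (u (contract v)) :> F.
Proof.
rewrite -[in RHS](opprK (contract v)) -contract_skew linearN opprK /=.
by rewrite /contract !dual_sum; apply: eq_bigr => i _; rewrite mulrC.
Qed.

Lemma tpair_sum (x y : I -> P) (u v : dual P) :
  tpair (\sum_i x i ⊗ y i) u v = \sum_i (u (x i) : F) * v (y i).
Proof.
by rewrite /tpair linear_sum; apply: eq_bigr => i _; apply: tpairE.
Qed.

Lemma dual_mul_coproduct (u v : dual P) x :
  dual_mul (coproduct_of mul r) u v x
  = (v (mul x (contract u)) : F) + u (mul (contract v) x).
Proof.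
rewrite dual_mulE; last exact: coproduct_linear.
rewrite coproductE sumrB /tpair linearB /= -!/(tpair _ u v) !tpair_sum.
congr (_ + _).
  by rewrite /contract (bilinear_sumr mulB) dual_sum.
(* In the second sum [v] is paired with [b i], so contracting gives minus [contract v]; this sign
   cancels the one in the coproduct. *)
rewrite -[contract v]opprK -contract_skew (bilinearNl mulB) linearN /=.
rewrite (bilinear_suml mulB) dual_sum; congr (- _).
by apply: eq_bigr => i _; rewrite mulrC.
Qed.

Lemma dual_mul_cobracket (u v : dual P) x :
  dual_mul (cobracket_of br r) u v x
  = (v (br x (contract u)) : F) - u (br x (contract v)).
Proof.
rewrite dual_mulE; last exact: cobracket_linear.
rewrite cobracketE big_split /tpair linearD /= -!/(tpair _ u v) !tpair_sum.
congr (_ + _).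
  by rewrite /contract (bilinear_sumr brB) dual_sum.
rewrite -[contract v]opprK -contract_skew (bilinearNr brB) linearN opprK /=.
rewrite (bilinear_sumr brB) dual_sum.
by apply: eq_bigr => i _; rewrite mulrC.
Qed.

Definition tpair3 (u v w : dual P) : tens P (tens P P) -> F^o :=
  tlift (fun x t => (u x : F) * tpair t v w : F^o).

Lemma tpair3E (u v w : dual P) x y z :
  tpair3 u v w (x ⊗ y ⊗ z) = (u x : F) * (v y * w z).
Proof.
rewrite /tpair3 tliftE ?tpairE // {x y z}.
split=> [t|x] k s s' /=; first by rewrite linearP /= mulrDl /GRing.scale /= mulrA.
by rewrite /tpair linearP mulrDr /GRing.scale /= mulrCA.
Qed.

Lemma dual_bilinear_sum (f : P -> P -> P) (fB : bilinear_map f) (u : dual P)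
    (k l : I -> F) (x y : I -> P) :
  u (f (\sum_i k i *: x i) (\sum_j l j *: y j))
  = \sum_i \sum_j (k i * l j * (u (f (x i) (y j)) : F)) :> F.
Proof.
rewrite (bilinear_suml fB) dual_sum; apply: eq_bigr => i _.
rewrite (bilinear_sumr fB) dual_sum mulr_sumr; apply: eq_bigr => j _.
by rewrite mulrA.
Qed.

(** In each term one leg carries a product and the other two, paired with functionals, become
    contractions. A functional paired with some [b] contributes a sign by [contract_skew]: two such
    signs cancel in the [u] term, and one absorbs the sign of r23 r12 in the [v] term. *)
Lemma tpair3_assoc_yb (u v w : dual P) :
  tpair3 u v w (assoc_yb mul r)
  = (u (mul (contract v) (contract w)) : F) + w (mul (contract u) (contract v))
    + v (mul (contract w) (contract u)).
Proof.
rewrite -[X in u (mul X _)]opprK -[X in u (mul _ X)]opprK -!contract_skew.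
rewrite (bilinearNl mulB) (bilinearNr mulB) opprK.
rewrite -[X in v (mul X _)]opprK -contract_skew (bilinearNl mulB) linearN /=.
rewrite !(dual_bilinear_sum mulB) /r assoc_ybE // /tpair3 linear_sum.
rewrite -sumrN -!big_split; apply: eq_bigr => i _.
rewrite linear_sum -sumrN -!big_split; apply: eq_bigr => j _ /=.
by rewrite linearB linearD /= -!/(tpair3 u v w _) !tpair3E; ring.
Qed.

Lemma tpair3_classical_yb (u v w : dual P) :
  tpair3 u v w (classical_yb br r)
  = (u (br (contract v) (contract w)) : F) - v (br (contract u) (contract w))
    + w (br (contract u) (contract v)).
Proof.
rewrite -[X in u (br X _)]opprK -[X in u (br _ X)]opprK -!contract_skew.
rewrite (bilinearNl brB) (bilinearNr brB) opprK.
rewrite -[X in v (br _ X)]opprK -contract_skew (bilinearNr brB) linearN opprK /=.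
rewrite !(dual_bilinear_sum brB) /r classical_ybE // /tpair3 linear_sum.
rewrite -!big_split; apply: eq_bigr => i _.
rewrite linear_sum -!big_split; apply: eq_bigr => j _ /=.
by rewrite !linearD /= -!/(tpair3 u v w _) !tpair3E; ring.
Qed.

(** * The Yang-Baxter equation and the algebra structure on the dual *)

Hypothesis r_pybe : poisson_yb mul br r.

(** Test against [w] and use [contract_adj] to evaluate the dual product at [contract w]. What
    remains is the pairing of A(r) = 0 with [u], [v], [w]. *)
Lemma contract_mul u v :
  contract (dual_mul (coproduct_of mul r) u v) = mul (contract u) (contract v).
Proof.
apply: dual_separates => w; have := tpair3_assoc_yb u v w.
rewrite (poisson_yb_assoc r_pybe) /tpair3 linear0 => E.
rewrite contract_adj dual_mul_coproduct; apply: oppr_inj.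
apply: (addIr (w (mul (contract u) (contract v)))); rewrite addNr E; ring.
Qed.

Lemma contract_br u v :
  contract (dual_mul (cobracket_of br r) u v) = br (contract u) (contract v).
Proof.
apply: dual_separates => w; have := tpair3_classical_yb u v w.
rewrite (poisson_yb_classical r_pybe) /tpair3 linear0 => E.
rewrite contract_adj dual_mul_cobracket.
rewrite (nc_brC (contract w) (contract u)) (nc_brC (contract w) (contract v)).
rewrite !linearN.
apply: oppr_inj; apply: (addIr (w (br (contract u) (contract v)))).
rewrite addNr E /=; ring.
Qed.

Lemma contract_linear : linear contract.
Proof.
move=> k u v; rewrite /contract scaler_sumr -big_split; apply: eq_bigr => i _ /=.
by rewrite !lfunE /= lfunE /= scalerDl scalerA.
Qed.

Lemma dual_coherent :
  coherent_nc_poisson (dual_mul (coproduct_of mul r)) (dual_mul (cobracket_of br r)).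
Proof.
have addE (u v : dual P) x : (u + v) x = (u x : F) + v x by rewrite lfunE.
have scaleE k (u : dual P) x : (k *: u) x = k * (u x : F) by rewrite lfunE.
have zeroE x : (0 : dual P) x = 0 by rewrite lfunE.
have linE (u : dual P) k x y : u (k *: x + y) = k * (u x : F) + u y.
  by rewrite linearP.
have dD (u : dual P) x y : u (x + y) = (u x : F) + u y by rewrite linearD.
have dN (u : dual P) x : u (- x) = - (u x : F) by rewrite linearN.
have dB (u : dual P) x y : u (x - y) = (u x : F) - u y by rewrite linearB.
pose E := (addE, dual_mul_coproduct, dual_mul_cobracket, contract_mul, contract_br).
split; first split.
- split=> [v|u] k s t; apply/lfunP => x; rewrite !(E, scaleE) contract_linear.
  + by rewrite (bilinearDr mulB) (bilinearZr mulB) linE; ring.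
  + by rewrite (bilinearDl mulB) (bilinearZl mulB) linE; ring.
(* With T for [contract], both sides equal w(x Tu Tv) + v(Tw x Tu) + u(Tv Tw x). *)
- by move=> u v w; apply/lfunP => x; rewrite !E !mulA addrA.
- split=> [v|u] k s t; apply/lfunP => x; rewrite !(E, scaleE) contract_linear;
  by rewrite (bilinearDr brB) (bilinearZr brB) linE; ring.
- by move=> u; apply/lfunP => x; rewrite E subrr zeroE.
- move=> u v w; apply/lfunP => x; rewrite zeroE !E.
  (* Jacobi is put in the form that nests brackets on the left starting from [x], as the evaluated
     double brackets do. *)
  have J y z : br x (br y z) = br (br x y) z - br (br x z) y.
    by rewrite brJ (nc_brC (br x z)) opprK subrK.
  by rewrite !J !dB; ring.
(* The left side contains u{x, Tv Tw}, while the right side has {Tw x, Tv} and {x Tv, Tw} under [u];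
   coherence identifies them. *)
- move=> u v w; apply/lfunP => x; rewrite !E coherentE !brMr.
  rewrite (nc_brC (contract v) (contract u)) (nc_brC (contract w) (contract u)).
  by rewrite (bilinearNl mulB) (bilinearNr mulB) !dD !dN; ring.
- move=> u v w; apply/lfunP => x; rewrite zeroE !E.
  (* After Leibniz in P, the terms in each functional cancel across the cyclic sum. *)
  by rewrite !brM !dD; ring.
Qed.

End Coboundary.

Theorem theorem4p4 (F : closedFieldType) (charF0 : [pchar F] =i pred0)
    (P : vectType F) (mul br : P -> P -> P)
    (hP : coherent_nc_poisson mul br)
    (r : tens P P) (r_skew : skew_tensor r) (r_pybe : poisson_yb mul br r) :
  coherent_nc_poisson (dual_mul (coproduct_of mul r)) (dual_mul (cobracket_of br r))
  /\ nc_poisson_bialgebra mul br (coproduct_of mul r) (cobracket_of br r).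
Proof.
have [I [a [b rE]]] := tens_finite_sum r; rewrite {r}rE in r_skew r_pybe *.
have dC := dual_coherent hP r_skew r_pybe; split=> //; split=> //.
- exact: (coproduct_linear hP).
- exact: (cobracket_linear hP).
- exact: (cobracket_skew hP).
- exact: (coproduct_mul hP).
- exact: (coproduct_br hP).
- exact: (cobracket_br hP).
- exact: (coproduct_sym hP).
- exact: (cobracket_mul hP).
Qed.
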